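(* For every integer $d \ge 2$ and every finite field $\mathbb{F}$ there is a constant $c = c(d, |\mathbb{F}|)$, depending only on $d$ and $|\mathbb{F}|$ and satisfying both $c \ge 2^{-d}$ and $c \ge 1 - \frac{\log(d-1)}{\log|\mathbb{F}|}$, such that the following holds. Let $V \cong \mathbb{F}^n$ be a finite-dimensional vector space over $\mathbb{F}$ (identified with $\mathbb{F}^n$ via a basis) and let $T : V^d \to \mathbb{F}$ be an order-$d$ tensor. Then: (i) $\mathrm{arank}(T) \le \mathrm{prank}(T)$. (ii) If $A \subseteq [n]$ is an independent set in $T$, then $\mathrm{arank}(T) \ge c\,|A|$.
   Context: Write $[n] = \{1,\ldots,n\}$. An order-$d$ tensor is a multilinear map $T : V^d \to \mathbb{F}$; with $V = \mathbb{F}^n$ it is written $T(x^1,\ldots,x^d) = \sum_{i_1,\ldots,i_d \in [n]} T_{i_1,\ldots,i_d}\, x^1_{i_1} \cdots x^d_{i_d}$ with coefficients $T_{i_1,\ldots,i_d} \in \mathbb{F}$. Analytic rank: fix a nontrivial additive character $\chi : \mathbb{F} \to \mathbb{C}$; put $\mathrm{bias}(T) = \mathbb{E}_{(x^1,\ldots,x^d) \in V^d}[\chi(T(x^1,\ldots,x^d))]$ (uniform expectation), which for $d \ge 2$ is a real number in $(0,1]$ and equals $\Pr_{x^2,\ldots,x^d \in V}[T(\cdot, x^2, \ldots, x^d) \equiv 0]$; and $\mathrm{arank}(T) = -\log_{|\mathbb{F}|} \mathrm{bias}(T)$. Partition rank: $T$ has partition rank one if it can be factored as $T(x^1,\ldots,x^d)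 = T_1(x^i : i \in B)\, T_2(x^j : j \notin B)$ for some $B \subset [d]$ with $1 \le |B| \le d-1$, where $T_1$ is an order-$|B|$ tensor and $T_2$ is an order-$(d-|B|)$ tensor. The partition rank $\mathrm{prank}(T)$ is the minimal $r \ge 1$ such that $T$ is a sum of $r$ tensors of partition rank one (the sets $B$ may differ between summands). Independent set: a subset $A \subseteq [n]$ is an independent set in $T$ if for all $i_1,\ldots,i_d \in A$: $T_{i_1,\ldots,i_d} \ne 0$ if and only if $i_1 = \cdots = i_d$. *)

(* Defs.v *)
From HB Require Import structures.
From mathcomp Require Import all_boot all_order all_algebra.
From mathcomp Require Import boolp classical_sets reals exp complex.

Set Implicit Arguments.
Unset Strict Implicit.
Unset Printing Implicit Defensive.

Import Order.TTheory GRing.Theory Num.Theory.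
Local Open Scope ring_scope.

Section Tensors.
Variables (F : finFieldType) (n : nat).

Definition update d (x : {ffun 'I_d -> 'rV[F]_n}) (k : 'I_d) (v : 'rV[F]_n) :
  {ffun 'I_d -> 'rV[F]_n} := [ffun l => if l == k then v else x l].

Definition multilinear d (T : {ffun 'I_d -> 'rV[F]_n} -> F) : Prop :=
  forall (x : {ffun 'I_d -> 'rV[F]_n}) (k : 'I_d) (a : F) (u v : 'rV[F]_n),
    T (update x k (a *: u + v)) = a * T (update x k u) + T (update x k v).

Record tensor (d : nat) := Tensor {
  tensor_fun :> {ffun 'I_d -> 'rV[F]_n} -> F;
  tensor_multilinear : multilinear tensor_fun }.

(* The coefficient T_{i_1,...,i_d} is the value of T at (e_{i_1},...,e_{i_d}). *)
Definition coef d (T : tensor d) (i : {ffun 'I_d -> 'I_n}) : F :=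
  T [ffun k => delta_mx 0 (i k)].

(* The family (x^k : k \in B), indexed by 'I_#|B| through the enumeration
   of B. *)
Definition subargs d (B : {set 'I_d}) (x : {ffun 'I_d -> 'rV[F]_n}) :
  {ffun 'I_#|B| -> 'rV[F]_n} := [ffun k => x (enum_val k)].

Definition partition_rank_one d (T : tensor d) : Prop :=
  exists B : {set 'I_d},
    (1 <= #|B| <= d - 1)%N /\
    exists (T1 : tensor #|B|) (T2 : tensor #|~: B|),
      forall x, T x = T1 (subargs B x) * T2 (subargs (~: B) x).

Definition sum_of_partition_rank_one d (T : tensor d) (r : nat) : Prop :=
  exists S : 'I_r -> tensor d,
    (forall s, partition_rank_one (S s)) /\
    (forall x, T x = \sum_(s < r) S s x).

Definition is_prank d (T : tensor d) (r : nat) : Prop :=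
  [/\ (1 <= r)%N, sum_of_partition_rank_one T r &
      forall s, (1 <= s)%N -> sum_of_partition_rank_one T s -> (r <= s)%N].

(* The default value 0 is never taken when d >= 2: see prankP. *)
Definition prank d (T : tensor d) : nat :=
  xget 0%N [set r | is_prank T r]%classic.

Definition independent_set d (T : tensor d) (A : {set 'I_n}) : Prop :=
  forall i : {ffun 'I_d -> 'I_n}, (forall k, i k \in A) ->
    (coef T i != 0 <-> forall k l, i k = i l).

Definition nontrivial_additive_character (R : realType) (chi : F -> R[i]) :
    Prop :=
  [/\ chi 0 = 1, {morph chi : a b / a + b >-> a * b} & exists a, chi a != 1].

Definition bias (R : realType) (chi : F -> R[i]) d (T : tensor d) : R[i] :=
  (\sum_(x : {ffun 'I_d -> 'rV[F]_n}) chi (T x))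
    / #|{: {ffun 'I_d -> 'rV[F]_n}}|%:R.

(* For d >= 2 the bias is a positive real number, so that taking its real part
   only changes its type. *)
Definition arank (R : realType) (chi : F -> R[i]) d (T : tensor d) : R :=
  - (ln (complex.Re (bias chi T)) / ln (#|F|%:R)).

Section PrankExists.
Variables (d : nat) (hd : (2 <= d)%N) (T : tensor d).

Let k0 : 'I_d := Ordinal (ltnW hd).
Let k1 : 'I_d := Ordinal hd.
Let B : {set 'I_d} := [set k0].

Let k0B : k0 \in B. Proof. exact: set11. Qed.
Let k1B : k1 \in ~: B. Proof. by rewrite !inE. Qed.

Let coord (j : nat) (v : 'rV[F]_n) : F := oapp (v 0) 0 (insub j).
Let basis (j : nat) : 'rV[F]_n := oapp (delta_mx 0) 0 (insub j : option 'I_n).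

Let fst_fun j (y : {ffun 'I_#|B| -> 'rV[F]_n}) : F :=
  coord j (y (enum_rank_in k0B k0)).

Let fst_multilinear j : multilinear (fst_fun j).
Proof.
move=> x k a u v; rewrite /fst_fun.
have -> : enum_rank_in k0B k0 = k.
  by apply/enum_val_inj; have := enum_valP k; rewrite enum_rankK_in // inE => /eqP.
rewrite !ffunE eqxx /coord; case: insub => [i|] /=; first by rewrite !mxE.
by rewrite mulr0 addr0.
Qed.

Let glue j (z : {ffun 'I_#|~: B| -> 'rV[F]_n}) : {ffun 'I_d -> 'rV[F]_n} :=
  [ffun l => if l == k0 then basis j else z (enum_rank_in k1B l)].

Let glue_update j z k v :
  glue j (update z k v) = update (glue j z) (enum_val k) v.
Proof.
have kN : enum_val k != k0 by have := enum_valP k; rewrite !inE.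
apply/ffunP => l; rewrite !ffunE.
case: (eqVneq l k0) => [->|lk0]; first by rewrite eq_sym (negPf kN).
congr (if _ then _ else _); apply/eqP/eqP => [<-|->].
  by rewrite enum_rankK_in // !inE.
by rewrite enum_valK_in.
Qed.

Let snd_fun j z : F := T (glue j z).

Let snd_multilinear j : multilinear (snd_fun j).
Proof. by move=> x k a u v; rewrite /snd_fun !glue_update tensor_multilinear. Qed.

Let slice_fun j x : F :=
  Tensor (@fst_multilinear j) (subargs B x) *
  Tensor (@snd_multilinear j) (subargs (~: B) x).

Let fst_slice j x : fst_fun j (subargs B x) = coord j (x k0).
Proof. by rewrite /fst_fun ffunE enum_rankK_in. Qed.

Let snd_slice j x : snd_fun j (subargs (~: B) x) = T (update x k0 (basis j)).
Proof.
rewrite /snd_fun; congr (T _); apply/ffunP => l; rewrite !ffunE.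
by case: (eqVneq l k0) => // lk0; rewrite enum_rankK_in // !inE.
Qed.

Let T_scale x (k : 'I_d) a u : T (update x k (a *: u)) = a * T (update x k u).
Proof.
have T0 : T (update x k 0) = 0.
  by have := tensor_multilinear T x k (-1) 0 0; rewrite scaler0 addr0 mulN1r addNr.
by have := tensor_multilinear T x k a u 0; rewrite T0 !addr0.
Qed.

Let T_sum x (k : 'I_d) m (u : 'I_m -> 'rV[F]_n) :
  T (update x k (\sum_i u i)) = \sum_i T (update x k (u i)).
Proof.
elim: m u => [|m IH] u.
  by rewrite !big_ord0 -[0 in LHS](scale0r 0) T_scale mul0r.
rewrite !big_ord_recl -IH -[u ord0 in LHS]scale1r tensor_multilinear.
by rewrite mul1r.
Qed.

Let slice_multilinear j : multilinear (slice_fun j).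
Proof.
move=> x k a u v; rewrite /slice_fun /= !fst_slice !snd_slice.
have upd0 w w' : update (update x k0 w) k0 w' = update x k0 w'.
  by apply/ffunP => l; rewrite !ffunE; case: eqP.
case: (eqVneq k k0) => [->|kk0].
  rewrite !upd0 !ffunE eqxx mulrA -mulrDl; congr (_ * _).
  rewrite /coord; case: insub => [i|] /=; first by rewrite !mxE.
  by rewrite mulr0 addr0.
have updC w : update (update x k w) k0 (basis j) =
              update (update x k0 (basis j)) k w.
  apply/ffunP => l; rewrite !ffunE.
  by case: (eqVneq l k0) => [->|]//; rewrite eq_sym (negPf kk0).
by rewrite !updC tensor_multilinear !ffunE eq_sym (negPf kk0) mulrDr mulrCA.
Qed.

Let prank_exists : sum_of_partition_rank_one T n.+1.
Proof.
exists (fun j : 'I_n.+1 => Tensor (@slice_multilinear j)); split=> [j|x].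
  exists B; split; first by rewrite cards1 /= leq_subRL // ltnW.
  by exists (Tensor (@fst_multilinear j)), (Tensor (@snd_multilinear j)).
rewrite big_ord_recr /= /slice_fun /= fst_slice /coord insubF ?ltnn //= mul0r.
rewrite addr0.
have -> : T x = T (update x k0 (x k0)).
  by congr (T _); apply/ffunP => l; rewrite ffunE; case: eqP => // ->.
rewrite [x k0 in LHS]row_sum_delta T_sum; apply: eq_bigr => i _.
by rewrite T_scale fst_slice snd_slice /coord /basis valK.
Qed.

Lemma prankP : is_prank T (prank T).
Proof.
have ex : exists r, (0 < r)%N && `[< sum_of_partition_rank_one T r >].
  by exists n.+1; apply/asboolP/prank_exists.
suff r_prank : is_prank T (ex_minn ex) by exact: (xgetPex 0%N (ex_intro _ _ r_prank)).
case: ex_minnP => r /andP[r0 /asboolP rT] rmin; split=> // s s0 sT.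
by apply: rmin; rewrite s0; apply/asboolP.
Qed.

End PrankExists.

End Tensors.

(* Main.v *)
(* Write bias(f) for the average of chi \o f. If h is additive in x^k and g does
   not depend on x^k, then |bias(h + g)| <= bias(h). Applied to one argument
   after another, this removes any translation: |bias(P + Q(phi(.) + z))| is at
   most bias(P + Q \o phi).
   - With phi the identity, averaging over z gives
     bias(P) bias(Q) <= bias(P + Q); a tensor of partition rank one has bias at
     least 1/q, so that bias(T) >= q ^ (- prank T).
   - With P = 0, Q = T and phi the coordinate projection onto A, it gives
     bias(T) <= bias(T|_A). On an independent set, T|_A is diagonal, of bias
     (1 - (1 - 1/q)^(d-1))^|A|. Hence
     c(d, q) = - log_q (1 - (1 - 1/q)^(d-1)). *)
Require Import Defs.
From HB Require Import structures.
From mathcomp Require Import all_boot all_order all_algebra.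
From mathcomp Require Import boolp classical_sets reals sequences exp complex.
From mathcomp Require Import ring lra.

Set Implicit Arguments.
Unset Strict Implicit.
Unset Printing Implicit Defensive.

Import Order.TTheory GRing.Theory Num.Theory.
Local Open Scope ring_scope.

(** * Bounds for the density of tuples with a zero entry *)

Section Density.
Variable R : realType.

Lemma bernoulli_inequality (t : R) e :
  0 <= t <= 1 -> 1 - e%:R * t <= (1 - t) ^+ e.
Proof.
case/andP=> t0 t1; elim: e => [|e IH]; first by rewrite mul0r subr0.
rewrite exprS; apply: le_trans (ler_wpM2l _ IH); last by rewrite subr_ge0.
rewrite -natr1; have : 0 <= e%:R * t * t by rewrite !mulr_ge0.
by lra.
Qed.

(* The proportion of e-tuples over a field with q elements having a zero
   entry. *)
Definition zero_density (q e : nat) : R := 1 - (1 - q%:R^-1) ^+ e.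

(** A union bound over the e entries, in the form of Bernoulli's inequality at t = 1/q. *)
Lemma zero_density_le q e : (2 <= q)%N -> zero_density q e <= e%:R / q%:R.
Proof.
move=> q2; have q0 : 0 < q%:R :> R by rewrite ltr0n; apply: leq_trans q2.
rewrite lerBlDl -lerBlDr; apply: bernoulli_inequality.
by rewrite invr_ge0 ltW //= invf_le1 // ler1n; apply: leq_trans q2.
Qed.

(** Keeps the density where [ln] is meaningful; at exponent 0 it vanishes, hence [e.+1]. *)
Lemma zero_density_gt0 q e : (2 <= q)%N -> 0 < zero_density q e.+1.
Proof.
move=> q2; have q0 : 0 < q%:R :> R by rewrite ltr0n; apply: leq_trans q2.
have q1 : q%:R^-1 < 1 :> R by rewrite invf_lt1 // ltr1n.
by rewrite subr_gt0 exprn_ilt1 // ?subr_ge0 ?ltW // gtrBl invr_gt0.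
Qed.

(* Induction on e: with t the right-hand side for e.+1 and s = t ^+ 2 the one
   for e, the bound (1 - 1/q) (1 - s) >= 1 - t amounts to t >= 1 / (q - 1),
   which follows from t ^+ 2 >= 1 / q when q >= 3. The case q = 2 is direct. *)
Lemma zero_density_le_root q e : (2 <= q)%N ->
  zero_density q e.+1 <= expR (- (ln q%:R / 2 ^+ e.+2)).
Proof.
move=> q2; have q0 : 0 < q%:R :> R by rewrite ltr0n; apply: leq_trans q2.
have L0 : 0 <= ln q%:R :> R by rewrite ln_ge0 // ler1n; apply: leq_trans q2.
rewrite /zero_density; case: (ltngtP q 2) q2 => // [q3 _|-> _]; last first.
  have -> : 1 - 2%:R^-1 = 2^-1 :> R by lra.
  (* Using 1 + x <= exp x at x = - 2^-(e+1), the claim reduces to ln 2 <= 2. *)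
  apply: le_trans (expR_ge1Dx _) _; rewrite ler_expR lerN2 exprVn.
  rewrite ler_pdivrMr ?exprn_gt0 // [_ ^+ e.+2]exprS mulrCA.
  rewrite mulVf ?mulr1 ?expf_neq0 ?pnatr_eq0 //.
  by apply/ltW/ln_sublinear.
(* [s m] is q^(-1/2^m), an iterated square root of 1/q. *)
pose s m : R := expR (- (ln q%:R / 2 ^+ m)).
have s0 m : 0 < s m by apply: expR_gt0.
have sS m : s m = s m.+1 ^+ 2.
  rewrite expr2 -expRD; congr expR; rewrite exprS invfM.
  by field; rewrite ?expf_neq0 ?pnatr_eq0.
have sq m : q%:R^-1 <= s m.
  rewrite -[X in X^-1]lnK ?posrE // -expRN ler_expR lerN2.
  by rewrite ler_pdivrMr ?exprn_gt0 // ler_peMr // exprn_ege1 // ler1n.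
rewrite lerBlDr -lerBlDl -/(s _).
have q3' : 3 <= q%:R :> R by rewrite ler_nat.
have qV : q%:R * q%:R^-1 = 1 :> R by rewrite mulfV ?lt0r_neq0.
elim: e => [|e IH].
  by have := sq 2; rewrite expr1; lra.
rewrite exprS; apply: le_trans (ler_wpM2l _ IH); last first.
  by rewrite subr_ge0 invf_le1 //; lra.
have := sq e.+2; rewrite sS; have := s0 e.+3; set t := s _ => t0 tq.
have t1 : t <= 1 by rewrite expR_le1 oppr_le0 divr_ge0 // exprn_ge0.
(* After squaring, t ^+ 2 >= 1/q leaves (q - 1)^2 >= q, true for q >= 3. *)
have tq1 : 1 <= t * (q%:R - 1).
  rewrite -(@ler_pXn2r _ 2) ?nnegrE ?mulr_ge0 ?(ltW t0) ?subr_ge0 ?ler01 //; last by lra.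
  rewrite expr1n exprMn; apply: le_trans (ler_wpM2r (sqr_ge0 _) tq).
  rewrite mulrC ler_pdivlMr // mul1r; nra.
have iq : 0 < q%:R^-1 :> R by rewrite invr_gt0.
have tq2 : 1 <= (1 - q%:R^-1) * (1 + t).
  rewrite -(ler_pM2l q0); nra.
have -> : (1 - q%:R^-1) * (1 - t ^+ 2) = (1 - q%:R^-1) * (1 + t) * (1 - t).
  by rewrite -[RHS]mulrA; congr (_ * _); ring.
by rewrite ler_peMl // subr_ge0.
Qed.
End Density.

(** * Counting in finite products and finite groups *)

(** Exchanging [v] with [x k] is an involution on the pairs (x, v). This allows summing over one
    argument first without splitting the index type. *)
Lemma sum_update (I V : finType) (M : nmodType) (f : {ffun I -> V} -> M) k :
  \sum_(x : {ffun I -> V}) \sum_v f [ffun l => if l == k then v else x l] =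
  (\sum_x f x) *+ #|V|.
Proof.
pose h (p : {ffun I -> V} * V) :=
  ([ffun l => if l == k then p.2 else p.1 l], p.1 k).
have hK : involutive h.
  case=> x v; rewrite /h /=; congr pair; last by rewrite ffunE eqxx.
  by apply/ffunP => l; rewrite !ffunE; case: eqP => // ->.
rewrite pair_big /= -sumrMnl.
under [RHS]eq_bigr do rewrite -sumr_const.
by rewrite pair_big [RHS](reindex_inj (inv_inj hK)).
Qed.

(** Each of the at most [#|F|] nonempty fibres is a translate of the kernel. *)
Lemma card_additive_kernel (F V : finZmodType) (h : V -> F) :
  {morph h : u v / u + v} -> (#|V| <= #|[pred v | h v == 0%R]| * #|F|)%N.
Proof.
move=> hD; rewrite -sum1_card (partition_big h xpredT) //=.
rewrite mulnC -sum_nat_const; apply: leq_sum => a _; rewrite sum1_card.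
case: (pickP (fun v => h v == a)) => [w /eqP hw|h0]; last by rewrite eq_card0.
have <- := card_image (@addIr _ (- w)) [pred v | h v == a].
apply: subset_leq_card; apply/fintype.subsetP => y /fintype.imageP[v hv ->].
move: hv; rewrite !inE => /eqP hv.
have h0 : h 0 = 0 by apply/(addrI (h 0)); rewrite -hD !addr0.
have -> : h (v - w) = h v - h w.
  by apply/(addIr (h w)); rewrite -hD !subrK.
by rewrite hv hw subrr.
Qed.

(** * Characters of a finite abelian group *)

Section FiniteCharacter.
Variables (V : finZmodType) (C : numFieldType) (psi : V -> C).
Hypotheses (psi0 : psi 0 = 1) (psiD : {morph psi : u v / u + v >-> u * v}).

(** Translation by a permutes V, so the product of all values of [psi] is unchanged by the factor
    [psi a ^+ #|V|]; hence [psi a] is a root of unity. *)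
Lemma char_norm a : `|psi a| = 1.
Proof.
have psi_neq0 b : psi b != 0.
  apply/eqP => pb0; have := psiD b (- b).
  by rewrite subrr psi0 pb0 mul0r => /eqP; rewrite oner_eq0.
have : psi a ^+ #|V| = 1.
  apply: (mulIf (x := \prod_b psi b)); first by apply/prodf_neq0 => b _.
  rewrite mul1r [RHS](reindex_inj (addrI a)) /=.
  by under [RHS]eq_bigr do rewrite psiD; rewrite big_split /= prodr_const.
move/(congr1 Num.norm); rewrite normrX normr1 => /eqP.
rewrite pexpr_eq1 ?normr_ge0 //; first by move/eqP.
by apply/card_gt0P; exists 0.
Qed.

(** Translation by a multiplies the sum by [psi a]. *)
Lemma sum_char_nontrivial a : psi a != 1 -> \sum_v psi v = 0.
Proof.
move=> pa; have : (psi a - 1) * \sum_v psi v = 0.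
  rewrite mulrBl mul1r [X in _ - X](reindex_inj (addrI a)) /= mulr_sumr.
  by under [X in _ - X]eq_bigr do rewrite psiD; rewrite subrr.
by move/eqP; rewrite mulf_eq0 subr_eq0 (negPf pa) /= => /eqP.
Qed.

Lemma sum_char_ge0 : 0 <= \sum_v psi v.
Proof.
case: (pickP (fun a => psi a != 1)) => [a /sum_char_nontrivial -> //|p1].
by apply: sumr_ge0 => v _; have /negbFE/eqP -> := p1 v; exact: ler01.
Qed.

End FiniteCharacter.

(** * Multilinear maps and their values on basis vectors *)

Section Multilinear.
Variables (F : finFieldType) (n d : nat).
Local Notation args := {ffun 'I_d -> 'rV[F]_n}.
Implicit Types (x : args) (k : 'I_d).

(** A weakening of multilinearity that a translated map retains in the arguments where the
    translation is zero. *)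
Definition additive_at k (f : args -> F) :=
  forall x, {morph (fun v => f (update x k v)) : u v / u + v}.

Lemma multilinearD (f : args -> F) x k u v : multilinear f ->
  f (update x k (u + v)) = f (update x k u) + f (update x k v).
Proof. by move=> fL; have := fL x k 1 u v; rewrite scale1r mul1r. Qed.

Lemma multilinear_additive (f : args -> F) k : multilinear f -> additive_at k f.
Proof. by move=> fL x u v; apply: multilinearD. Qed.

Lemma update_id x k : update x k (x k) = x.
Proof. by apply/ffunP => l; rewrite ffunE; case: eqP => // ->. Qed.

Lemma update_update x k u v : update (update x k u) k v = update x k v.
Proof. by apply/ffunP => l; rewrite !ffunE; case: eqP. Qed.

Lemma multilinear0 (f : args -> F) x k :
  multilinear f -> f (update x k 0) = 0.
Proof.
by move=> fL; have := fL x k (-1) 0 0; rewrite scaler0 addr0 mulN1r addNr.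
Qed.

Lemma multilinear_sum (f : args -> F) x k m (c : 'I_m -> F) u :
  multilinear f ->
  f (update x k (\sum_j c j *: u j)) = \sum_j c j * f (update x k (u j)).
Proof.
move=> fL; elim: m c u => [|m IH] c u.
  by rewrite !big_ord0 multilinear0.
by rewrite !big_ord_recl fL IH.
Qed.

Lemma multilinear_zero : multilinear (fun _ : args => 0 : F).
Proof. by move=> x k a u v; rewrite mulr0 addr0. Qed.

Lemma multilinear_bigsum r (f : 'I_r -> args -> F) :
  (forall s, multilinear (f s)) -> multilinear (fun x => \sum_s f s x).
Proof.
move=> fL x k a u v; rewrite mulr_sumr -big_split /=.
by apply: eq_bigr => s _; rewrite fL.
Qed.

(** Arguments are expanded in the basis one at a time; m bounds the positions not yet known to hold
    basis vectors. *)
Lemma multilinear_eq (k0 : 'I_d) (f g : args -> F) :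
  multilinear f -> multilinear g ->
  (forall i : {ffun 'I_d -> 'I_n}, f [ffun k => delta_mx 0 (i k)] =
                                   g [ffun k => delta_mx 0 (i k)]) ->
  f =1 g.
Proof.
(* When n = 0 there are no basis vectors to evaluate on; every argument is then 0 and both maps
   vanish. *)
move=> fL gL fg x; case: (posnP n) => [n0|n_gt0].
  have xE : update x k0 0 = x.
    apply/ffunP => k; rewrite ffunE; case: eqP => // _.
    apply/rowP => j; exfalso; have := ltn_ord j.
    by rewrite [X in (_ < X)%N]n0.
  by rewrite -xE !multilinear0.
suff: forall m (i : {ffun 'I_d -> 'I_n}) x,
    (forall k : 'I_d, (m <= k)%N -> x k = delta_mx 0 (i k)) -> f x = g x.
  move=> H; apply: (H d [ffun=> Ordinal n_gt0] x) => k.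
  by rewrite leqNgt ltn_ord.
move=> {x}; elim=> [|m IH] i x xE.
  by have -> : x = [ffun k => delta_mx 0 (i k)]; [apply/ffunP => k; rewrite ffunE xE|].
have [dm|md] := leqP d m.
  by apply: (IH i) => k /(leq_trans dm); rewrite leqNgt ltn_ord.
pose k := Ordinal md; rewrite -(update_id x k) [x k]row_sum_delta.
rewrite !multilinear_sum //; apply: eq_bigr => j _; congr (_ * _).
apply: (IH [ffun l => if l == k then j else i l]) => l ml; rewrite !ffunE.
case: eqP => // /eqP lk; apply: xE; rewrite ltn_neqAle ml andbT.
by apply: contra lk => /eqP e; apply/eqP/val_inj.
Qed.

(** * Character sums and their positivity along lines *)

Section CharacterSum.
Variables (C : numFieldType) (chi : F -> C).
Hypotheses (chi0 : chi 0 = 1) (chiD : {morph chi : a b / a + b >-> a * b}).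

(** The bias before normalisation. *)
Definition char_sum (f : args -> F) : C := \sum_x chi (f x).

Lemma char_sum_update k f :
  char_sum f * #|{: 'rV[F]_n}|%:R = \sum_x \sum_v chi (f (update x k v)).
Proof. by rewrite mulr_natr -(sum_update _ k). Qed.

Lemma card_rV_gt0 : 0 < #|{: 'rV[F]_n}|%:R :> C.
Proof. by rewrite ltr0n; apply/card_gt0P; exists 0. Qed.

(** Restricted to a line in direction k, [chi \o f] is again a character. *)
Lemma sum_line_ge0 k f x :
  additive_at k f -> 0 <= \sum_v chi (f (update x k v)).
Proof.
move=> fD; apply: (sum_char_ge0 (psi := fun v => chi (f (update x k v)))).
by move=> u v /=; rewrite (fD x u v) chiD.
Qed.

(* Summing first over the k-th argument, each inner sum of chi \o h is
   nonnegative, and g only multiplies it by a phase. *)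
Lemma char_sum_drop k h g :
  additive_at k h -> (forall x v, g (update x k v) = g x) ->
  `|char_sum (fun x => h x + g x)| <= char_sum h.
Proof.
move=> hD gk; rewrite -(ler_pM2r card_rV_gt0) (char_sum_update k h).
rewrite -[X in _ * X]ger0_norm ?(ltW card_rV_gt0) // -normrM.
rewrite (char_sum_update k); apply: le_trans (ler_norm_sum _ _ _) _.
apply: ler_sum => x _; under eq_bigr do rewrite chiD gk.
rewrite -mulr_suml normrM (char_norm chi0 chiD) mulr1.
by rewrite ger0_norm // sum_line_ge0.
Qed.

Lemma char_sum_ge0 k h : additive_at k h -> 0 <= char_sum h.
Proof.
move=> hD; rewrite -(pmulr_lge0 _ card_rV_gt0) (char_sum_update k).
by apply: sumr_ge0 => x _; apply: sum_line_ge0.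
Qed.

(** * Removing translations *)

Definition shift (phi : 'rV[F]_n -> 'rV[F]_n) (x z : args) : args :=
  [ffun k => phi (x k) + z k].

Lemma shift_update phi x z k v :
  shift phi (update x k v) z = update (shift phi x z) k (phi v + z k).
Proof. by apply/ffunP => l; rewrite !ffunE; case: eqP => // ->. Qed.

(** The entries of z are replaced by 0 one after another: the term of Q carrying [z k] does not
    depend on [x k], so [char_sum_drop] discards it. *)
Lemma char_sum_shift k0 P Q phi z :
  multilinear P -> multilinear Q -> {morph phi : u v / u + v} ->
  `|char_sum (fun x => P x + Q (shift phi x z))| <=
  char_sum (fun x => P x + Q (shift phi x [ffun=> 0])).
Proof.
move=> PL QL phiD.
(* The first m entries are zeroed, so [trunc] runs from z at m = 0 to 0 at m = d. *)
pose trunc m : args := [ffun k : 'I_d => if (k < m)%N then 0 else z k].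
pose f m x := P x + Q (shift phi x (trunc m)).
have fD m k : trunc m k = 0 -> additive_at k (f m).
  move=> tk x u v; rewrite /f !shift_update tk !addr0 phiD.
  by rewrite (multilinearD _ _ _ _ PL) (multilinearD _ _ _ _ QL) addrACA.
have t0 : trunc 0%N = z by apply/ffunP => k; rewrite ffunE.
have td : trunc d = [ffun=> 0] by apply/ffunP => k; rewrite !ffunE ltn_ord.
have -> : (fun x => P x + Q (shift phi x z)) = f 0%N by rewrite /f t0.
rewrite -td -/(f d) -[X in _ <= X]ger0_norm; last first.
  by apply: (char_sum_ge0 (k := k0)); apply: fD; rewrite td ffunE.
suff H m : (m <= d)%N -> `|char_sum (f 0%N)| <= `|char_sum (f m)| by exact: H.
elim: m => [//|m IH md]; apply: le_trans (IH (ltnW md)) _.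
pose k := Ordinal md.
have tk : trunc m.+1 k = 0 by rewrite ffunE ltnSn.
have tm : trunc m = update (trunc m.+1) k (z k).
  apply/ffunP => l; rewrite !ffunE; case: (eqVneq l k) => [->|lk].
    by rewrite ltnn.
  rewrite ltnS (leq_eqVlt l); case: (eqVneq (l : nat) m) => // e.
  by case/eqP: lk; apply: val_inj.
(* Splitting [phi (x k) + z k] in the k-th argument of Q, g is the part at [z k]. *)
pose g x := Q (update (shift phi x (trunc m.+1)) k (z k)).
have -> : f m = fun x => f m.+1 x + g x.
  apply/funext => x; rewrite /f -addrA; congr (_ + _).
  rewrite /g -{1}(update_id (shift phi x (trunc m.+1)) k).
  rewrite -(multilinearD _ _ _ _ QL); congr Q; apply/ffunP => l.
  by rewrite ffunE tm !ffunE; case: eqP => [->|//]; rewrite ltnSn addr0.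
apply: le_trans (char_sum_drop (fD _ _ tk) _) (real_ler_norm _).
  by move=> x v; rewrite /g shift_update update_update.
by apply: ger0_real; apply: char_sum_ge0 (fD _ _ tk).
Qed.

Lemma sum_shift (G : args -> C) phi x : \sum_z G (shift phi x z) = \sum_z G z.
Proof.
have hI : injective (shift phi x).
  by move=> y z /ffunP e; apply/ffunP => k; have := e k; rewrite !ffunE => /addrI.
by rewrite [RHS](reindex_inj hI).
Qed.

Lemma shift_id0 x : shift id x [ffun=> 0] = x.
Proof. by apply/ffunP => k; rewrite !ffunE addr0. Qed.

(** Substituting y = x + z in the double sum over x and y gives one translated sum per z, each
    bounded by the untranslated one. *)
Lemma char_sum_add k0 P Q : multilinear P -> multilinear Q ->
  char_sum P * char_sum Q <= #|{: args}|%:R * char_sum (fun x => P x + Q x).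
Proof.
move=> PL QL.
have PQE : char_sum P * char_sum Q =
           \sum_z char_sum (fun x => P x + Q (shift id x z)).
  rewrite exchange_big /= mulr_suml; apply: eq_bigr => x _.
  rewrite /char_sum -(sum_shift (chi \o Q) id x) mulr_sumr.
  by apply: eq_bigr => z _; rewrite chiD.
have PQ0 : 0 <= char_sum P * char_sum Q.
  by apply: mulr_ge0; apply: (char_sum_ge0 (k := k0)); apply: multilinear_additive.
have -> : (fun x => P x + Q x) = (fun x => P x + Q (shift id x [ffun=> 0])).
  by apply/funext => x; rewrite shift_id0.
rewrite mulr_natl -sumr_const -(ger0_norm PQ0) PQE.
apply: le_trans (ler_norm_sum _ _ _) _; apply: ler_sum => z _.
exact: char_sum_shift.
Qed.

(** Induction on r through [char_sum_add], which makes the bias supermultiplicative once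
    denominators are restored. *)
Lemma char_sum_bigsum k0 r (f : 'I_r -> args -> F) (a : C) :
  0 <= a -> (forall s, multilinear (f s)) ->
  (forall s, a * #|{: args}|%:R <= char_sum (f s)) ->
  a ^+ r * #|{: args}|%:R <= char_sum (fun x => \sum_s f s x).
Proof.
move=> a0; have N0 : 0 < #|{: args}|%:R :> C.
  by rewrite ltr0n; apply/card_gt0P; exists [ffun=> 0].
elim: r f => [|r IH] f fL fa.
  rewrite /char_sum; under eq_bigr do rewrite big_ord0 chi0.
  by rewrite sumr_const mul1r.
under [X in char_sum X]eq_fun do rewrite big_ord_recl.
have gL : multilinear (fun x => \sum_s f (lift ord0 s) x).
  exact: multilinear_bigsum.
rewrite -(ler_pM2l N0); apply: le_trans (char_sum_add k0 (fL _) gL).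
have -> : #|{: args}|%:R * (a ^+ r.+1 * #|{: args}|%:R) =
  (a * #|{: args}|%:R) * (a ^+ r * #|{: args}|%:R) :> C.
  by rewrite exprS mulrACA [RHS]mulrA mulrC.
have aN m : 0 <= a ^+ m * #|{: args}|%:R.
  by rewrite mulr_ge0 ?exprn_ge0 // ltW.
apply: ler_pM (fa _) (IH _ _ _) => //; first exact: (aN 1%N).
Qed.

(* Each line sum over the k-th argument is nonnegative, and equals its length
   where g vanishes, which has density at least 1 / #|F|. *)
Lemma char_sum_product k l h g :
  additive_at k h -> additive_at l g ->
  (forall x v, g (update x k v) = g x) ->
  #|F|%:R^-1 * #|{: args}|%:R <= char_sum (fun x => h x * g x).
Proof.
move=> hD gD gk; have V0 := card_rV_gt0.
have F0 : 0 < #|F|%:R :> C by rewrite ltr0n; apply/card_gt0P; exists 0.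
have hgD : additive_at k (fun x => h x * g x).
  by move=> x u v; rewrite !gk hD mulrDl.
rewrite ler_pdivrMl // -(ler_pM2r V0) -mulrA (char_sum_update k).
have H : \sum_x (g x == 0)%:R * #|{: 'rV[F]_n}|%:R <=
         \sum_x \sum_v chi (h (update x k v) * g (update x k v)).
  apply: ler_sum => x _; case: eqP => gx; last first.
    by rewrite mul0r; exact: sum_line_ge0 x hgD.
  by under eq_bigr do rewrite gk gx mulr0 chi0; rewrite sumr_const mul1r.
apply: le_trans (ler_wpM2l (ltW F0) H); rewrite -mulr_suml mulr_natr.
(* Zeros of g are counted on each line in direction l, where g is additive and its kernel has
   density at least 1 / #|F|. *)
rewrite -(sum_update _ l) -sumr_const mulr_suml mulr_sumr.
apply: ler_sum => x _.
have -> : \sum_v (g (update x l v) == 0)%:R =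
          #|[pred v | g (update x l v) == 0]|%:R :> C.
  rewrite -sum1_card natr_sum [RHS]big_mkcond /=; apply: eq_bigr => v _.
  by rewrite inE; case: eqP.
by rewrite mul1r mulrC -natrM ler_nat; apply: card_additive_kernel (gD x).
Qed.

(** * Diagonal tensors and independent sets *)

(** Summing over the k0-th entry first gives q if the product of the others vanishes and 0
    otherwise, so the value is q times the number of (d-1)-tuples with a zero entry. *)
Lemma sum_char_prod (k0 : 'I_d) (a b : F) : chi b != 1 -> a != 0 ->
  \sum_(c : {ffun 'I_d -> F}) chi (a * \prod_k c k) =
  #|F|%:R ^+ d - #|F|%:R * (#|F|%:R - 1) ^+ (d - 1).
Proof.
move=> chib a0; set q : C := #|F|%:R.
have q_neq0 : q != 0 by rewrite pnatr_eq0 -lt0n; apply/card_gt0P; exists 0.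
have line (p : F) : \sum_v chi (a * (v * p)) = q * (p == 0)%:R.
  case: eqP => [->|/eqP p0].
    by under eq_bigr do rewrite !mulr0 chi0; rewrite sumr_const mulr1.
  rewrite mulr0; apply: (@sum_char_nontrivial _ _ (fun v => chi (a * (v * p)))
    _ (b / a / p)) => [u v|] /=; first by rewrite mulrDl mulrDr chiD.
  by rewrite divfK // mulrC divfK.
(* [1 - \prod_k G k (c k)] indicates a zero entry away from k0; its product form lets the sum over c
   factor. *)
pose G (k : 'I_d) (t : F) : C := ((k != k0) ==> (t != 0))%:R.
apply/(mulIf q_neq0); rewrite mulr_natr -(sum_update _ k0).
transitivity (\sum_(c : {ffun 'I_d -> F}) q * (1 - \prod_k G k (c k))).
  apply: eq_bigr => c _.
  have upd v : \prod_k [ffun l => if l == k0 then v else c l] k =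
               v * \prod_(k | k != k0) c k.
    rewrite (bigD1 k0) //= ffunE eqxx; congr (_ * _).
    by apply: eq_bigr => k /negPf kk0; rewrite ffunE kk0.
  transitivity (\sum_v chi (a * (v * \prod_(k | k != k0) c k))).
    by apply: eq_bigr => v _; rewrite -upd.
  rewrite line; congr (_ * _); rewrite [X in 1 - X](bigD1 k0) //= /G eqxx mul1r.
  case: eqP => [/eqP /prodf_eq0[k kk0 /eqP ck]|/eqP/prodf_neq0 cn].
    by rewrite (bigD1 k) //= ck kk0 eqxx mul0r subr0.
  by rewrite big1 ?subrr // => k kk0; rewrite kk0 cn.
rewrite -mulr_sumr sumrB -bigA_distr_bigA /= sumr_const card_ffun card_ord.
rewrite natrX mulrC; congr (_ * _); congr (_ - _).
rewrite (bigD1 k0) //= /G eqxx /= sumr_const; congr (_ * _).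
rewrite (eq_bigr (fun=> q - 1)) => [|k /negPf ->].
  by rewrite prodr_const cardC1 card_ord subn1.
rewrite (bigD1 0) //= eqxx add0r (eq_bigr (fun=> 1)) => [|t ->] //.
rewrite sumr_const cardC1 /q -subn1 natrB //.
by apply/card_gt0P; exists 0.
Qed.

Definition diagonal (A : {set 'I_n}) (a : 'I_n -> F) x :=
  \sum_(i in A) a i * \prod_k x k 0 i.

Lemma diagonal_multilinear A a : multilinear (diagonal A a).
Proof.
move=> x k c u v; rewrite mulr_sumr -big_split /=; apply: eq_bigr => i _.
have upd w : \prod_l (update x k w) l 0 i =
             w 0 i * \prod_(l | l != k) x l 0 i.
  rewrite (bigD1 k) //= ffunE eqxx; congr (_ * _).
  by apply: eq_bigr => l /negPf lk; rewrite ffunE lk.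
by rewrite !upd !mxE mulrDl mulrDr !mulrA (mulrC c).
Qed.

(** The sum factors over the coordinates i: those in A contribute [sum_char_prod], the others
    q^d. *)
Lemma char_sum_diagonal k0 (A : {set 'I_n}) (a : 'I_n -> F) b :
  chi b != 1 -> (forall i, i \in A -> a i != 0) ->
  char_sum (diagonal A a) =
  #|{: args}|%:R * (1 - (1 - #|F|%:R^-1) ^+ (d - 1)) ^+ #|A|.
Proof.
move=> chib a0; set q : C := #|F|%:R.
have q_neq0 : q != 0 by rewrite pnatr_eq0 -lt0n; apply/card_gt0P; exists 0.
(* [col] assembles the d row vectors from their n columns in F^d. *)
pose col (f : {ffun 'I_n -> {ffun 'I_d -> F}}) : args :=
  [ffun k => \row_i f i k].
have col_bij : bijective col.
  exists (fun x : args => [ffun i => [ffun k => x k 0 i]]) => f.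
    by apply/ffunP => i; apply/ffunP => k; rewrite !ffunE mxE.
  by apply/ffunP => k; apply/rowP => i; rewrite ffunE mxE !ffunE.
have chi_sum (I : finType) (P : pred I) (f : I -> F) :
    chi (\sum_(i | P i) f i) = \prod_(i | P i) chi (f i).
  by apply: (big_morph chi chiD chi0).
pose G i (c : {ffun 'I_d -> F}) : C :=
  if i \in A then chi (a i * \prod_k c k) else 1.
rewrite /char_sum (reindex col) /=; last exact: onW_bij.
transitivity (\sum_(f : {ffun 'I_n -> {ffun 'I_d -> F}}) \prod_i G i (f i)).
  apply: eq_bigr => f _; rewrite chi_sum big_mkcond /=.
  apply: eq_bigr => i _; rewrite /G; case: ifP => // _; congr (chi (_ * _)).
  by apply: eq_bigr => k _; rewrite ffunE mxE.
rewrite -bigA_distr_bigA /=.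
pose beta : C := 1 - (1 - q^-1) ^+ (d - 1).
have GE i : \sum_c G i c = q ^+ d * (if i \in A then beta else 1).
  rewrite /G; case: ifP => iA; last first.
    by rewrite sumr_const card_ffun card_ord natrX mulr1.
  rewrite (sum_char_prod k0 chib (a0 i iA)) -/q /beta mulrBr mulr1.
  congr (_ - _).
  have dE : d = (d - 1).+1 by rewrite subn1 prednK ?(leq_ltn_trans _ (ltn_ord k0)).
  by rewrite {2}dE exprS -mulrA -exprMn mulrBr mulr1 divff.
under eq_bigr do rewrite GE.
rewrite big_split /= -big_mkcond /= !prodr_const card_ord; congr (_ * _).
by rewrite card_ffun card_ord card_mx mul1n natrX natrX -!exprM mulnC.
Qed.

Lemma char_sum_independent k0 (T : tensor F n d) (A : {set 'I_n}) b :
  chi b != 1 -> independent_set T A ->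
  char_sum T <= #|{: args}|%:R * (1 - (1 - #|F|%:R^-1) ^+ (d - 1)) ^+ #|A|.
Proof.
move=> chib indA; have TL := tensor_multilinear T.
pose phi (v : 'rV[F]_n) : 'rV[F]_n := \row_j (if j \in A then v 0 j else 0).
have phiL c u v : phi (c *: u + v) = c *: phi u + phi v.
  by apply/rowP => j; rewrite !mxE; case: ifP => // _; rewrite mulr0 addr0.
have phiD : {morph phi : u v / u + v}.
  by move=> u v; have := phiL 1 u v; rewrite !scale1r.
have phi_delta j : phi (delta_mx 0 j) = if j \in A then delta_mx 0 j else 0.
  apply/rowP => i; rewrite !mxE eqxx /=; case: (eqVneq i j) => [->|ij].
    by case: ifP; rewrite !mxE ?eqxx.
  by case: ifP; case: ifP; rewrite !mxE ?eqxx ?(negPf ij).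
(* Both sides are compared on basis tuples: some index outside A, all indices equal, or two distinct
   indices within A. *)
have TphiE : (fun x => T (shift phi x [ffun=> 0])) =1
             diagonal A (fun j => coef T [ffun=> j]).
  apply: (multilinear_eq k0) => [x k c u v||i].
  - by rewrite !shift_update !ffunE !addr0 phiL TL.
  - exact: diagonal_multilinear.
  have [iA|] := boolP [forall k, i k \in A]; last first.
    rewrite negb_forall => /existsP[k ikA].
    rewrite -(update_id (shift _ _ _) k) !ffunE phi_delta (negPf ikA) addr0.
    rewrite multilinear0 // /diagonal big1 // => j jA.
    rewrite (bigD1 k) //= ffunE mxE eqxx /=.
    case: eqP => [jE|_]; first by rewrite -jE jA in ikA.
    by rewrite mul0r mulr0.
  move/forallP in iA.
  have -> : shift phi [ffun k => delta_mx 0 (i k)] [ffun=> 0] =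
            [ffun k => delta_mx 0 (i k)].
    by apply/ffunP => k; rewrite !ffunE phi_delta iA addr0.
  rewrite -/(coef T i); have [ic|] := boolP [forall k, i k == i k0].
    have iE : i = [ffun=> i k0].
      by apply/ffunP => k; rewrite ffunE; apply/eqP/(forallP ic).
    rewrite /diagonal (bigD1 (i k0)) //= -iE big1 ?mulr1.
      rewrite big1 ?addr0 // => j /andP[_ jk].
      by rewrite (bigD1 k0) //= ffunE mxE eqxx (negPf jk) mul0r mulr0.
    by move=> k _; rewrite ffunE mxE eqxx /= (eqP (forallP ic k)) eqxx.
  rewrite negb_forall => /existsP[k ik].
  have -> : coef T i = 0.
    apply/eqP; apply: contraNT ik => Ti; apply/eqP; exact: (proj1 (indA i iA) Ti k k0).
  rewrite /diagonal big1 // => j _.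
  case: (eqVneq j (i k)) => [->|jk].
    by rewrite (bigD1 k0) //= ffunE mxE eqxx (negPf ik) mul0r mulr0.
  by rewrite (bigD1 k) //= ffunE mxE eqxx (negPf jk) mul0r mulr0.
rewrite -(char_sum_diagonal k0 (a := fun j => coef T [ffun=> j]) chib); last first.
  by move=> j jA; apply/(indA [ffun=> j]) => [k|k l]; rewrite !ffunE.
have N0 : 0 < #|{: args}|%:R :> C.
  by rewrite ltr0n; apply/card_gt0P; exists [ffun=> 0].
have T0 : 0 <= char_sum T.
  by apply: (char_sum_ge0 (k := k0)); apply: multilinear_additive.
rewrite -(ler_pM2r N0).
(* For fixed x the tuple phi(x) + z runs over all arguments, so [char_sum T] is the average over z
   of the translated sums. *)
have TE : char_sum T * #|{: args}|%:R =
          \sum_z char_sum (fun x => 0 + T (shift phi x z)).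
  rewrite exchange_big /= mulr_natr -sumr_const; apply: eq_bigr => x _.
  rewrite /char_sum -(sum_shift (chi \o T) phi x).
  by apply: eq_bigr => z _; rewrite add0r.
have TN : 0 <= char_sum T * #|{: args}|%:R by rewrite mulr_ge0 // ltW.
rewrite -(ger0_norm TN) TE; apply: le_trans (ler_norm_sum _ _ _) _.
rewrite mulr_natr -sumr_const; apply: ler_sum => z _.
apply: le_trans (char_sum_shift k0 z multilinear_zero TL phiD) _.
rewrite /char_sum; under eq_bigr do rewrite add0r TphiE.
exact: lexx.
Qed.

(** * Tensors of bounded partition rank *)

Lemma subargs_update (B : {set 'I_d}) x (j : 'I_#|B|) v :
  subargs B (update x (enum_val j) v) = update (subargs B x) j v.
Proof.
by apply/ffunP => l; rewrite !ffunE (inj_eq enum_val_inj).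
Qed.

Lemma subargs_update_notin (B : {set 'I_d}) x k v :
  k \notin B -> subargs B (update x k v) = subargs B x.
Proof.
move=> kB; apply/ffunP => l; rewrite !ffunE; case: eqP => // lk.
by rewrite -lk enum_valP in kB.
Qed.

Lemma subargs_additive (B : {set 'I_d}) (T : tensor F n #|B|) (j : 'I_#|B|) :
  additive_at (enum_val j) (fun x => T (subargs B x)).
Proof.
move=> x u v /=; rewrite !subargs_update.
by have := tensor_multilinear T (subargs B x) j 1 u v; rewrite scale1r mul1r.
Qed.

(** Taking k in B and l in its complement, the second factor does not depend on [x k], as
    [char_sum_product] requires. *)
Lemma char_sum_partition_rank_one (T : tensor F n d) : partition_rank_one T ->
  #|F|%:R^-1 * #|{: args}|%:R <= char_sum T.
Proof.
case=> B [/andP[B0 Bd] [T1 [T2 TE]]].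
(* With truncated subtraction, d - 1 < d needs d > 0, which follows from B being nonempty. *)
have B'0 : (0 < #|~: B|)%N.
  rewrite cardsCs finset.setCK card_ord subn_gt0; apply: leq_ltn_trans Bd _.
  by rewrite subn1 prednK // (leq_trans B0) // -[X in (_ <= X)%N](card_ord d) max_card.
rewrite /char_sum; under eq_bigr do rewrite TE.
apply: (char_sum_product (k := enum_val (Ordinal B0)) (l := enum_val (Ordinal B'0))
  (h := fun x => T1 (subargs B x)) (g := fun x => T2 (subargs (~: B) x))).
- exact: subargs_additive.
- exact: subargs_additive.
move=> x v; rewrite subargs_update_notin // inE negbK; exact: enum_valP.
Qed.

Lemma char_sum_prank k0 (T : tensor F n d) r : sum_of_partition_rank_one T r ->
  #|F|%:R ^- r * #|{: args}|%:R <= char_sum T.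
Proof.
case=> S [S1 TE]; rewrite /char_sum; under eq_bigr do rewrite TE.
rewrite -exprVn; apply: (char_sum_bigsum k0) => [|s|s].
- by rewrite invr_ge0.
- exact: tensor_multilinear.
- exact: char_sum_partition_rank_one.
Qed.

End CharacterSum.
End Multilinear.

(** * From character sums to the real-valued bias *)

Section Bias.
Variables (R : realType) (F : finFieldType) (chi : F -> R[i]).
Hypothesis chi_char : nontrivial_additive_character chi.
Variables (n d : nat) (k0 : 'I_d) (T : tensor F n d).

Let chi0 : chi 0 = 1. Proof. by case: chi_char. Qed.
Let chiD : {morph chi : a b / a + b >-> a * b}. Proof. by case: chi_char. Qed.

Let N_gt0 : 0 < #|{: {ffun 'I_d -> 'rV[F]_n}}|%:R :> R[i].
Proof. by rewrite ltr0n; apply/card_gt0P; exists [ffun=> 0]. Qed.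

(** Bounds proved in [R[i]] thereby transfer to the real part used in [arank]. *)
Lemma bias_real : (complex.Re (bias chi T))%:C%C = bias chi T.
Proof.
apply/RRe_real/ger0_real; apply: divr_ge0; last exact: ltW.
have TD : additive_at k0 T.
  by apply: multilinear_additive; apply: tensor_multilinear.
exact: (@char_sum_ge0 F n d _ chi chiD k0 T TD).
Qed.

Lemma bias_ge_prank r : sum_of_partition_rank_one T r ->
  #|F|%:R ^- r <= complex.Re (bias chi T).
Proof.
move=> Tr; rewrite -lecR bias_real ler_pdivlMr // fmorphV rmorphXn rmorph_nat.
exact: (char_sum_prank chi0 chiD k0 Tr).
Qed.

Lemma bias_le_independent A : independent_set T A ->
  complex.Re (bias chi T) <= zero_density R #|F| (d - 1) ^+ #|A|.
Proof.
move=> indA; case: chi_char => _ _ [b chib].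
rewrite -lecR bias_real ler_pdivrMr // mulrC /zero_density.
rewrite rmorphXn rmorphB rmorph1 rmorphXn rmorphB rmorph1 fmorphV rmorph_nat.
exact: (char_sum_independent chi0 chiD k0 chib indA).
Qed.

End Bias.

(** * The constant and the two rank inequalities *)

Theorem theorem1p7 (R : realType) :
  exists c : nat -> nat -> R,
    forall (d : nat) (F : finFieldType), (2 <= d)%N ->
      [/\ 2 ^- d <= c d #|F|,
          1 - ln ((d - 1)%N%:R) / ln (#|F|%:R) <= c d #|F| &
          forall chi : F -> R[i], nontrivial_additive_character chi ->
          forall (n : nat) (T : tensor F n d),
            arank chi T <= (prank T)%:R /\
            (forall A : {set 'I_n}, independent_set T A ->
               c d #|F| * #|A|%:R <= arank chi T)].
Proof.
exists (fun d q => - (ln (zero_density R q (d - 1)) / ln q%:R)) => d F d2.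
have q2 := finalg.card_finNzRing_gt1 F; set q := #|F| in q2 *.
have lnq : 0 < ln q%:R :> R by rewrite ln_gt0 // ltr1n.
have q0 : 0 < q%:R :> R by rewrite ltr0n; apply: leq_trans q2.
have [e dE] : exists e, (d - 1 = e.+1)%N by exists d.-2; case: d d2 => [|[|]].
have d1E : d = e.+2 by rewrite -dE subn1 prednK // ltnW.
have beta0 : 0 < zero_density R q e.+1 by apply: zero_density_gt0.
rewrite dE; split.
(* Exponentiated, the bound 2^-d <= c says that the density is at most q^(-2^-d). *)
- rewrite d1E -mulNr ler_pdivlMr // lerNr mulrC.
  by rewrite -ler_expR lnK ?posrE //; apply: zero_density_le_root.
(* The second bound is the logarithm of the density being at most (d - 1)/q. *)
- have e0 : 0 < e.+1%:R :> R by rewrite ltr0n.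
  rewrite -[X in X - _](divff (lt0r_neq0 lnq)) -mulrBl -mulNr.
  rewrite ler_pM2r ?invr_gt0 // lerNr opprB -ln_div ?posrE //.
  by rewrite ler_ln ?posrE ?divr_gt0 //; apply: zero_density_le.
move=> chi chi_char n T; pose k0 : 'I_d := Ordinal (ltnW d2).
(* As d >= 2, [prank T] is attained by a decomposition and is not the default 0. *)
have [_ Tr _] := prankP d2 T.
have bq := bias_ge_prank chi_char k0 Tr.
have b0 : 0 < complex.Re (bias chi T).
  by apply: lt_le_trans bq; rewrite invr_gt0 exprn_gt0.
rewrite /arank; split=> [|A indA].
  rewrite lerNl ler_pdivlMr // mulNr mulr_natl -lnXn // -lnV ?posrE ?exprn_gt0 //.
  by rewrite ler_ln // posrE // invr_gt0 exprn_gt0.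
(* Taking logarithms turns the power #|A| of the density into the factor #|A| of c. *)
have := bias_le_independent chi_char k0 indA; rewrite dE -/q => bA.
rewrite mulNr lerN2 mulrAC ler_pM2r ?invr_gt0 // mulr_natr -lnXn //.
by rewrite ler_ln // posrE exprn_gt0.
Qed.
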